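(* Let $G$ and $H$ be finite simple graphs with $\alpha(G)\le 2$ and $\alpha(H)\le 2$, and suppose $|V(H)|\le 4$. If $G$ is $H$-free, then $G$ contains the complete graph $K_{\lceil n/2\rceil}$ as an immersion, where $n=|V(G)|$.
   Context: $\alpha(\cdot)$ denotes the independence number. $G$ is $H$-free if $G$ has no induced subgraph isomorphic to $H$. A graph $G$ contains a graph $K$ as an immersion if there is an injective map $\phi\colon V(K)\to V(G)$ such that for every edge $uv\in E(K)$ there is a path $P_{uv}$ in $G$ with endpoints $\phi(u),\phi(v)$, the paths $P_{uv}$ ($uv\in E(K)$) are pairwise edge-disjoint, and no vertex of $\phi(V(K))$ (the branch vertices) is an interior vertex of any path $P_{uv}$. *)

(* Defs.v *)
From mathcomp Require Import all_boot.

Set Implicit Arguments.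
Unset Strict Implicit.
Unset Printing Implicit Defensive.

Record sgraph := SGraph {
  vertex :> finType;
  adj : rel vertex;
  adj_sym : symmetric adj;
  adj_irrefl : irreflexive adj
}.

Definition edges (G : sgraph) : {set {set G}} :=
  [set [set e.1; e.2] | e : G * G & adj e.1 e.2].

Definition independent (G : sgraph) (S : {set G}) : bool :=
  [forall x in S, forall y in S, ~~ adj x y].

Definition independence_number (G : sgraph) : nat :=
  \max_(S : {set G} | independent S) #|S|.

Section Induced.
Variables (G : sgraph) (S : {set G}).

Definition induced_adj : rel {x : G | x \in S} :=
  fun x y => adj (val x) (val y).

Lemma induced_adj_sym : symmetric induced_adj.
Proof. by move=> x y; rewrite /induced_adj adj_sym. Qed.

Lemma induced_adj_irrefl : irreflexive induced_adj.
Proof. by move=> x; rewrite /induced_adj adj_irrefl. Qed.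

Definition induced : sgraph := SGraph induced_adj_sym induced_adj_irrefl.
End Induced.

Definition isomorphic (G H : sgraph) : Prop :=
  exists2 f : G -> H, bijective f & forall x y, adj (f x) (f y) = adj x y.

Definition is_free (G H : sgraph) : Prop :=
  forall S : {set G}, ~ isomorphic (induced S) H.

Section Complete.
Variable n : nat.

Definition complete_adj : rel 'I_n := fun i j => i != j.

Lemma complete_adj_sym : symmetric complete_adj.
Proof. by move=> i j; rewrite /complete_adj eq_sym. Qed.

Lemma complete_adj_irrefl : irreflexive complete_adj.
Proof. by move=> i; rewrite /complete_adj eqxx. Qed.

Definition complete : sgraph := SGraph complete_adj_sym complete_adj_irrefl.
End Complete.

(* A path is given by the sequence of all its vertices, without repetition;
   its two endpoints form an unordered pair. *)
Definition path_between (G : sgraph) (x y : G) (s : seq G) : bool :=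
  if s is x0 :: p then
    [&& path (@adj G) x0 p, uniq s & [set x0; last x0 p] == [set x; y]]
  else false.

Definition path_edges (G : sgraph) (s : seq G) : seq {set G} :=
  if s is x :: p then pairmap (fun a b => [set a; b]) x p else [::].

Definition path_interior (G : sgraph) (s : seq G) : seq G :=
  if s is x :: p then behead (belast x p) else [::].

(* The paths are indexed by unordered pairs of vertices of K, so that each edge
   uv = vu gets a single path; values of P outside of edges K are irrelevant. *)
Definition immersion (G K : sgraph) : Prop :=
  exists (phi : K -> G) (P : {set K} -> seq G),
    [/\ injective phi,
        forall u v : K, adj u v -> path_between (phi u) (phi v) (P [set u; v]),
        {in edges K &, forall e f, e != f ->
           [disjoint path_edges (P e) & path_edges (P f)]}
      & {in edges K, forall e (w : K), phi w \notin path_interior (P e)}].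

(* Main.v *)
Require Import Defs.
From mathcomp Require Import all_boot zify.

Set Implicit Arguments.
Unset Strict Implicit.
Unset Printing Implicit Defensive.

(** Non-adjacency in [G] is a triangle-free graph [F], in which [d] denotes degree. Take
    a set [S] of vertices, minimal among those whose induced graph has no immersion of
    half its size; then [#|S| = 2k - 1]. Three constructions restrict [S]. A neighbourhood
    of [F], being a clique of [G], has fewer than [k] vertices. If [x] and [y] are
    [F]-adjacent and [d x + d y <= k], then [x] can be added to the branch vertices of an
    immersion in [S] minus [x] and [y], by paths [x - z - y - b] with distinct [z]. If
    [d v = k - 1] and [w] has only one [F]-neighbour among those of [v], then [w] can be
    added to the clique of [F]-neighbours of [v]. Hence [k >= 5], and
    [F] restricted to [S] contains every triangle-free graph on four vertices:
    most follow from counting, avoiding [P_3 + K_1] or [K_2 + 2K_1] leads to a 5-cycle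
    that cannot be extended by a further vertex, and avoiding [2K_2] forces a blow-up of
    the 5-cycle, where an immersion is built explicitly. *)

(** * Immersions of complete graphs inside a vertex set *)

Section CliqueImmersions.
Variable G : sgraph.
Implicit Types (S T B : {set G}) (x y z : G).

(** The map [phi] of [immersion] is here the inclusion of the set [B] of branch vertices, and all
    paths stay in [S], so that an immersion can be grown one vertex at a time inside a larger
    set. *)
Definition immersed S B : Prop :=
  B \subset S /\ exists P : {set G} -> seq G,
    [/\ {in B &, forall x y, x != y -> path_between x y (P [set x; y])},
        {in B &, forall x y, x != y -> {subset P [set x; y] <= S}},
        {in B & &, forall x y w, x != y -> w \notin path_interior (P [set x; y])}
      & forall x y x' y', x \in B -> y \in B -> x' \in B -> y' \in B ->
          x != y -> x' != y' -> [set x; y] != [set x'; y'] ->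
          [disjoint path_edges (P [set x; y]) & path_edges (P [set x'; y'])]].

Lemma immersed0 S : immersed S set0.
Proof.
split; first exact: sub0set.
by exists (fun=> [::]); split=> [x y|x y|x y w|x y x' y']; rewrite inE.
Qed.

Lemma immersedW S T B B' :
  S \subset T -> B' \subset B -> immersed S B -> immersed T B'.
Proof.
move=> /subsetP ST sB [BS [P [h1 h2 h3 h4]]].
split; first by apply: subset_trans (subset_trans sB BS) _; apply/subsetP.
move/subsetP: sB => sB.
exists P; split=> [x y /sB xB /sB yB|x y /sB xB /sB yB ne z|x y w /sB xB /sB yB /sB wB|].
- exact: h1.
- by move/(h2 x y xB yB ne)/ST.
- exact: h3.
- by move=> x y x' y' /sB xB /sB yB /sB xB' /sB yB'; apply: h4.
Qed.

Lemma path_edges_sub S (s : seq G) (e : {set G}) :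
  {subset s <= S} -> e \in path_edges s -> e \subset S.
Proof.
case: s => [|x p] //=; elim: p x => [|y p IH] x //= sub.
rewrite inE => /orP[/eqP->|]; last by apply: IH => z zp; apply: sub; rewrite inE zp orbT.
by rewrite subUset !sub1set !sub ?inE ?eqxx ?orbT.
Qed.

(** Old paths have their edges inside [S] and every edge of a new path has an end outside [S], so
    old and new paths share no edge, and no old path meets [x]. Only the new paths have to be
    compared with each other. *)
Lemma immersed_extend S T B x (Q : G -> seq G) :
    immersed S B -> S \subset T -> x \notin S -> x \in T ->
    {in B, forall b, path_between x b (Q b)} ->
    {in B, forall b, {subset Q b <= T}} ->
    {in B, forall b, {in x |: B, forall w, w \notin path_interior (Q b)}} ->
    {in B, forall b e, e \in path_edges (Q b) -> ~~ (e \subset S)} ->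
    {in B &, forall b b', b != b' ->
       [disjoint path_edges (Q b) & path_edges (Q b')]} ->
  immersed T (x |: B).
Proof.
move=> [BS [P [h1 h2 h3 h4]]] ST xS xT q1 q2 q3 q4 q5.
have xB : x \notin B by apply: contra xS; apply: (subsetP BS).
split.
  by rewrite subUset sub1set xT (subset_trans BS ST).
(* For [e = [set x; b]] the endpoint [b] is recovered by [pick]; the default is reached only by [e =
   [set x]], which is no pair of distinct vertices. *)
pose P' (e : {set G}) := if x \in e then Q (odflt x [pick b in e :\ x]) else P e.
have PQ b : b \in B -> P' [set x; b] = Q b.
  move=> bB; rewrite /P' !inE eqxx /=; case: pickP => [c|/(_ b)] /=; last first.
    rewrite !inE eqxx orbT andbT => /negbFE /eqP bx.
    by rewrite -bx bB in xB.
  by rewrite !inE => /andP[/negbTE->] /eqP->.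
have PQ' b : b \in B -> P' [set b; x] = Q b by rewrite setUC; apply: PQ.
have PP a b : a \in B -> b \in B -> P' [set a; b] = P [set a; b].
  move=> aB bB; rewrite /P' !inE; case: eqP => [ax|_]; first by rewrite ax aB in xB.
  by case: eqP => [ax|_] //; rewrite ax bB in xB.
have symB a b s : path_between a b s -> path_between b a s.
  by case: s => //= c p; rewrite (setUC [set b]).
have xI a b : a \in B -> b \in B -> a != b -> x \notin path_interior (P [set a; b]).
  move=> aB bB ab; apply: contra xS => xi; apply: (h2 a b) => //.
  case: (P [set a; b]) xi => //= c p /mem_behead xi.
  by apply: mem_belast.
have dPQ a b c : a \in B -> b \in B -> a != b -> c \in B ->
    [disjoint path_edges (P [set a; b]) & path_edges (Q c)].
  move=> aB bB ab cB; apply/pred0P => e /=; apply/negP => /andP[e1 e2].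
  by move: (q4 c cB e e2); rewrite (path_edges_sub (h2 a b aB bB ab) e1).
exists P'; split.
- move=> a b /setU1P[->|aB] /setU1P[->|bB] ab; first by rewrite eqxx in ab.
  + by rewrite PQ //; apply: q1.
  + by rewrite PQ' //; apply/symB/q1.
  + by rewrite PP //; apply: h1.
- move=> a b /setU1P[->|aB] /setU1P[->|bB] ab; first by rewrite eqxx in ab.
  + by rewrite PQ //; apply: q2.
  + by rewrite PQ' //; apply: q2.
  + by rewrite PP // => z zp; apply: (subsetP ST); apply: h2 zp.
- move=> a b w /setU1P[->|aB] /setU1P[->|bB] wB ab; first by rewrite eqxx in ab.
  + by rewrite PQ //; apply: q3.
  + by rewrite PQ' //; apply: q3.
  + rewrite PP //; case/setU1P: wB => [->|wB]; [exact: xI|exact: h3].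
- move=> a b a' b' /setU1P[->|aB] /setU1P[->|bB] /setU1P[->|aB'] /setU1P[->|bB'];
    rewrite ?eqxx // => ab ab' ne; rewrite ?PQ ?PQ' ?PP //.
  + by apply: q5 => //; apply: contraNneq ne => ->.
  + by apply: q5 => //; apply: contraNneq ne => ->; rewrite setUC.
  + by rewrite disjoint_sym dPQ.
  + by apply: q5 => //; apply: contraNneq ne => ->; rewrite setUC.
  + by apply: q5 => //; apply: contraNneq ne => ->.
  + by rewrite disjoint_sym dPQ.
  + by apply: dPQ.
  + by apply: dPQ.
  + by apply: h4.
Qed.

Lemma eq_set2 (a b c d : G) :
  [set a; b] = [set c; d] -> a = c /\ b = d \/ a = d /\ b = c.
Proof.
move=> E.
have /set2P[ac|ad] : a \in [set c; d] by rewrite -E set21.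
  have /set2P[bc|bd] : b \in [set c; d] by rewrite -E set22.
    have /set2P[da|db] : d \in [set a; b] by rewrite E set22.
      by left; rewrite ac bc da ac.
    by left; rewrite db.
  by left.
have /set2P[bc|bd] : b \in [set c; d] by rewrite -E set22.
  by right.
have /set2P[ca|cb] : c \in [set a; b] by rewrite E set21.
  by right; rewrite ad bd ca ad.
by right; rewrite cb.
Qed.

(** A branch vertex [b] not adjacent to [x] is reached along [x - f b - y - b], the others by an
    edge. These paths share [y] but no edge: [f] is injective on such [b], and [f b] lies outside
    [B], so [f b - y] is never some [y - c]. *)
Lemma immersed_add S T B x y (f : G -> G) :
    immersed S B -> S \subset T -> x \in T -> x \notin S -> y \notin S -> x != y ->
    (forall b, b \in B -> ~~ adj x b ->
       [/\ y \in T, f b \in T & f b \notin B] /\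
       [/\ adj x (f b), adj (f b) y & adj y b]) ->
    {in B &, forall b c, ~~ adj x b -> ~~ adj x c -> f b = f c -> b = c} ->
  immersed T (x |: B).
Proof.
move=> imm ST xT xS yS xy H inj.
have adj_neq a b : @adj G a b -> a != b.
  by move=> ab; apply: contraTneq ab => ->; rewrite adj_irrefl.
have [BS _] := imm.
have neB z b : z \notin S -> b \in B -> z != b.
  by move=> zS bB; apply: contraNneq zS => ->; apply: (subsetP BS).
pose Q b := if adj x b then [:: x; b] else [:: x; f b; y; b].
apply: (immersed_extend (Q := Q) imm ST xS xT).
- move=> b bB; rewrite /Q; case: ifP => ab /=.
    by rewrite ab inE adj_neq // eqxx.
  have [[_ _ fB] [a1 a2 a3]] := H _ bB (negbT ab).
  rewrite a1 a2 a3 !inE !negb_or eqxx /= xy (adj_neq _ _ a1) (adj_neq _ _ a2).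
  by rewrite (adj_neq _ _ a3) (neB x) //= !andbT; apply: contraNneq fB => ->.
- move=> b bB z; rewrite /Q; case: ifP => ab /=.
    by rewrite !inE => /orP[]/eqP-> //; apply: (subsetP ST); apply: (subsetP BS).
  have [[yT fT fB] _] := H _ bB (negbT ab).
  rewrite !inE => /or4P[]/eqP-> //.
  by apply: (subsetP ST); apply: (subsetP BS).
- move=> b bB w wB; rewrite /Q; case: ifP => ab //=.
  have [[_ _ fB] [a1 a2 a3]] := H _ bB (negbT ab).
  rewrite !inE negb_or; case/setU1P: wB => [->|wB]; first by rewrite xy adj_neq.
  apply/andP; split; first by apply: contraNneq fB => <-.
  by rewrite eq_sym neB.
- move=> b bB e; rewrite /Q; case: ifP => ab /=.
    by rewrite inE => /eqP->; apply: contra xS => /subsetP; apply; rewrite !inE eqxx.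
  rewrite !inE => /or3P[]/eqP->.
  + by apply: contra xS => /subsetP; apply; rewrite !inE eqxx.
  + by apply: contra yS => /subsetP; apply; rewrite !inE eqxx orbT.
  + by apply: contra yS => /subsetP; apply; rewrite !inE eqxx.
- move=> b c bB cB bc; rewrite /Q.
  have NS b' z : b' \in B -> z \notin S -> z <> b'.
    by move=> bB' zS; apply/eqP/neB.
  have nf d : d \in B -> ~~ adj x d -> [/\ x <> f d, f d <> y, f d <> b & f d <> c].
    move=> dB ad; have [[_ _ fB] [/adj_neq/eqP a1 /adj_neq/eqP a2 _]] := H _ dB ad.
    by split=> // fd; rewrite fd ?bB ?cB in fB.
  move/eqP: xy => xy; move/eqP: bc => bc.
  have [xb xc yb yc] := And4 (NS b x bB xS) (NS c x cB xS) (NS b y bB yS) (NS c y cB yS).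
  apply/pred0P => e /=; apply/negP => /andP[].
  case: ifP => [_|/negbT ab]; case: ifP => [_|/negbT ac] /=; rewrite !inE.
  + by move=> /eqP-> /eqP/eq_set2; intuition congruence.
  + have [? ? ? ?] := nf c cB ac.
    by move=> /eqP-> /or3P[]/eqP/eq_set2; intuition congruence.
  + have [? ? ? ?] := nf b bB ab.
    by move=> /or3P[]/eqP-> /eqP/eq_set2; intuition congruence.
  + have [? ? ? ?] := nf c cB ac; have [? ? ? ?] := nf b bB ab.
    have fbc : f b <> f c by move=> fbc; apply: bc; apply: inj fbc.
    by move=> /or3P[]/eqP-> /or3P[]/eqP/eq_set2; intuition congruence.
Qed.

Lemma immersed_add_universal S B x :
  immersed S B -> x \notin S -> {in B, forall b, adj x b} -> immersed (x |: S) (x |: B).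
Proof.
move=> imm xS adjB; have [/subsetP BS _] := imm.
have xB : x \notin B by apply: contra xS; apply: BS.
pose Q b := [:: x; b]; apply: (immersed_extend (Q := Q) imm) => //.
- exact: subsetUr.
- exact: setU11.
- by move=> b bB /=; rewrite adjB // inE eqxx !andbT; apply: contraNneq xB => ->.
- by move=> b /BS bS z; rewrite !inE => /orP[]/eqP->; rewrite ?eqxx ?bS ?orbT.
- move=> b bB e; rewrite inE => /eqP->; apply: contra xS => /subsetP; apply.
  by rewrite !inE eqxx.
- move=> b c bB cB bc; apply/pred0P => e /=.
  apply/negP => /andP[]; rewrite !inE => /eqP-> /eqP/eq_set2[[_ bc']|[xc _]].
    by rewrite bc' eqxx in bc.
  by rewrite xc cB in xB.
Qed.

Lemma immersed_clique B : {in B &, forall x y, x != y -> adj x y} -> immersed B B.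
Proof.
elim: {B}#|B| {-2}B (erefl #|B|) => [|n IH] B cB cl.
  by move/eqP: cB; rewrite cards_eq0 => /eqP->; apply: immersed0.
have [x xB] : exists x, x \in B by apply/set0Pn; rewrite -card_gt0 cB.
rewrite -(setD1K xB); apply: immersed_add_universal; last 2 first.
- by rewrite !inE eqxx.
- by move=> b /setD1P[bx bB]; rewrite cl // eq_sym.
apply: IH; first by move: cB; rewrite (cardsD1 x) xB => -[].
by move=> a b /setD1P[_ aB] /setD1P[_ bB]; apply: cl.
Qed.

Lemma immersion_of_immersed B : immersed [set: G] B -> immersion G (complete #|B|).
Proof.
move=> [_ [P [h1 _ h3 h4]]].
pose phi (i : complete #|B|) : G := enum_val i.
have phiB i : phi i \in B by apply: enum_valP.
have inj : injective phi by apply: enum_val_inj.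
have im i j : phi @: [set i; j] = [set phi i; phi j] by rewrite imsetU1 imset_set1.
exists phi, (fun e : {set complete #|B|} => P (phi @: e)); split=> //.
- by move=> u v uv; rewrite im; apply: h1 => //; rewrite (inj_eq inj).
- move=> e f /imsetP[[u v]]; rewrite inE => /= uv -> /imsetP[[u' v']].
  rewrite inE => /= uv' -> ne; rewrite !im; apply: h4; rewrite ?(inj_eq inj) //.
  by apply: contraNneq ne => E; apply/eqP/(imset_inj inj); rewrite !im.
- move=> e /imsetP[[u v]]; rewrite inE => /= uv -> w; rewrite im.
  by apply: h3; rewrite ?(inj_eq inj).
Qed.

End CliqueImmersions.

(** * Minimal counterexamples *)

Definition nonadj (G : sgraph) (x y : G) : bool := (x != y) && ~~ adj x y.

Definition nonnbrs (G : sgraph) (S : {set G}) (x : G) : {set G} :=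
  [set y in S | nonadj x y].

Definition is_clique (G : sgraph) (I : {set G}) : bool :=
  [forall x in I, forall y in I, ~~ nonadj x y].

Definition half_immersed (G : sgraph) (S : {set G}) : Prop :=
  exists2 B : {set G}, immersed S B & uphalf #|S| <= #|B|.

(** The fields are decidable consequences of minimality, in place of the absence of a half-size
    immersion; this allows a case distinction without classical reasoning. *)
Record critical (G : sgraph) (S : {set G}) (k : nat) : Prop := Critical {
  critical_card : #|S|.+1 = k.*2;
  critical_edge : {in S &, forall x y, nonadj x y ->
    k < #|nonnbrs S x| + #|nonnbrs S y|};
  critical_clique : forall I : {set G}, I \subset S -> is_clique I -> #|I| < k;
  critical_gt0 : {in S, forall x, 0 < #|nonnbrs S x|};
  critical_star : {in S &, forall v w, #|nonnbrs S v| = k.-1 -> w != v ->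
    ~~ nonadj v w -> 1 < #|nonnbrs S w :&: nonnbrs S v|}
}.

Section Basics.
Variable G : sgraph.
Implicit Types (S T B I : {set G}) (x y z : G).

Lemma nonadjC x y : nonadj x y = nonadj y x.
Proof. by rewrite /nonadj eq_sym adj_sym. Qed.

Lemma nonadjxx x : nonadj x x = false.
Proof. by rewrite /nonadj eqxx. Qed.

Lemma nonadjN x y : x != y -> ~~ nonadj x y = adj x y.
Proof. by move=> xy; rewrite /nonadj xy negbK. Qed.

Lemma nonadj_neq x y : nonadj x y -> x != y.
Proof. by case/andP. Qed.

Lemma nonadj_adj x y : nonadj x y -> ~~ adj x y.
Proof. by case/andP. Qed.

Lemma in_nonnbrs S x y : (y \in nonnbrs S x) = (y \in S) && nonadj x y.
Proof. by rewrite inE. Qed.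

Lemma nonnbrs_sub S x : nonnbrs S x \subset S.
Proof. by apply/subsetP => y; rewrite inE => /andP[]. Qed.

Lemma cliqueP I : reflect {in I &, forall x y, ~~ nonadj x y} (is_clique I).
Proof.
apply: (iffP forall_inP) => [H x y xI yI|H x xI]; last by apply/forall_inP => y; apply: H.
exact: (forall_inP (H x xI)).
Qed.

Lemma clique_immersed I : is_clique I -> immersed I I.
Proof.
by move/cliqueP => cI; apply: immersed_clique => x y xI yI xy; rewrite -nonadjN ?cI.
Qed.

Lemma half_immersed_clique S I :
  I \subset S -> is_clique I -> uphalf #|S| <= #|I| -> half_immersed S.
Proof. by move=> IS /clique_immersed cI le; exists I => //; apply: immersedW cI. Qed.

Lemma exists_subset_card B m : m <= #|B| -> exists2 A : {set G}, A \subset B & #|A| = m.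
Proof.
move=> le; exists [set x in take m (enum B)].
  by apply/subsetP => x; rewrite inE => /mem_take; rewrite mem_enum.
rewrite cardsE (card_uniqP _) ?take_uniq ?enum_uniq //.
by rewrite size_take_min -cardE; apply/minn_idPl.
Qed.

Lemma inj_in_of_leq_card (A Z : {set G}) : #|A| <= #|Z| ->
  exists f : G -> G, {in A &, injective f} /\ {in A, forall a, f a \in Z}.
Proof.
have [->|[a0 _]] := set_0Vmem A.
  by exists id; split=> [x y|x]; rewrite inE.
move=> le; exists (fun a => nth a0 (enum Z) (index a (enum A))).
have lt a : a \in A -> index a (enum A) < size (enum Z).
  by move=> aA; rewrite -cardE (leq_trans _ le) // cardE index_mem mem_enum.
split=> [a b aA bA /eqP|a aA]; last by rewrite -mem_enum mem_nth ?lt.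
rewrite nth_uniq ?lt ?enum_uniq // => /eqP ab.
by apply: (index_inj a0 _ _ ab); rewrite mem_enum.
Qed.

Lemma half_immersed_exact S m : half_immersed S -> m <= uphalf #|S| ->
  exists2 B, immersed S B & #|B| = m.
Proof.
move=> [B iB le] lem; have [A AB cA] := exists_subset_card (leq_trans lem le).
by exists A => //; apply: immersedW iB.
Qed.

Hypothesis alphaG : independence_number G <= 2.

Lemma nonadj_triangle_free x y z : nonadj x y -> nonadj y z -> nonadj x z -> False.
Proof.
move=> xy yz xz.
have ind : independent [set x; y; z].
  apply/forall_inP => a aI; apply/forall_inP => b bI.
  have [->|ab] := eqVneq a b; first by rewrite adj_irrefl.
  apply: nonadj_adj; move: ab aI bI; rewrite !inE -!orbA.
  by move=> ab /or3P[]/eqP ea /or3P[]/eqP eb; subst; rewrite ?eqxx // in ab *; rewrite // nonadjC.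
have : #|[set x; y; z]| <= 2.
  apply: leq_trans alphaG.
  exact: (@leq_bigmax_cond _ (@independent G) (fun S : {set G} => #|S|)).
by rewrite -setUA !cardsU1 cards1 !inE !negb_or !nonadj_neq.
Qed.

Lemma adj_of_common x y z : nonadj z x -> nonadj z y -> x != y -> adj x y.
Proof.
move=> zx zy xy; rewrite -nonadjN //; apply/negP => xy'.
exact: nonadj_triangle_free zx xy' zy.
Qed.

Lemma nonnbrs_clique S x : is_clique (nonnbrs S x).
Proof.
apply/cliqueP => y z; rewrite !inE => /andP[_ xy] /andP[_ xz]; apply/negP => yz.
exact: nonadj_triangle_free xy yz xz.
Qed.

(** * Enlarging immersions when every smaller set has one of half its size *)

Section Step.
Variable S : {set G}.
Hypothesis IH : forall T, #|T| < #|S| -> half_immersed T.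

(** For even size, deleting one vertex leaves [uphalf] unchanged. *)
Lemma half_immersed_even : ~~ odd #|S| -> half_immersed S.
Proof.
have [->|[x xS]] := set_0Vmem S; first by exists set0; rewrite ?cards0 //; apply: immersed0.
move=> ev; have cS := cardsD1 x S; rewrite xS in cS.
have [|B iB le] := IH (T := S :\ x); first by lia.
by exists B; [apply: immersedW iB => //; apply: subsetDl | lia].
Qed.

Variable k : nat.
Hypothesis cardS : #|S|.+1 = k.*2.

Lemma half_immersed_universal x : x \in S -> #|nonnbrs S x| = 0 -> half_immersed S.
Proof.
move=> xS /eqP; rewrite cards_eq0 => /eqP N0.
have cS := cardsD1 x S; rewrite xS in cS.
have [|B iB le] := IH (T := S :\ x); first by lia.
have [BS _] := iB.
have xB : x \notin B by apply/negP => /(subsetP BS); rewrite !inE eqxx.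
have adjB b : b \in B -> adj x b.
  move=> bB; have /setD1P[bx bS] := subsetP BS _ bB.
  rewrite -nonadjN 1?eq_sym //; apply/negP => xb.
  by have : b \in nonnbrs S x by [rewrite inE bS]; rewrite N0 inE.
exists (x |: B); last by rewrite cardsU1 xB; lia.
rewrite -(setD1K xS); apply: immersed_add_universal => //.
by rewrite !inE eqxx.
Qed.

(** Remove [x] and [y], take [k - 1] branch vertices in the rest and add [x]. The degree bound
    leaves enough common neighbours of [x] and [y] for each detour to have its own. *)
Lemma half_immersed_edge x y : x \in S -> y \in S -> nonadj x y ->
  #|nonnbrs S x| + #|nonnbrs S y| <= k -> half_immersed S.
Proof.
move=> xS yS xy led.
pose T := S :\ x :\ y.
have xney := nonadj_neq xy.
have cT : #|T| + 2 = #|S|.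
  have := cardsD1 x S; have := cardsD1 y (S :\ x); rewrite xS !inE yS eq_sym xney /= /T; lia.
have [B iB cB] : exists2 B, immersed T B & #|B| = k.-1.
  by apply: half_immersed_exact; [apply: IH; lia|lia].
have [BT _] := iB.
have TS : T \subset S by apply: subset_trans (subsetDl _ _) (subsetDl _ _).
have xT : x \notin T by rewrite !inE eqxx andbF.
have yT : y \notin T by rewrite !inE eqxx.
have xB : x \notin B by apply: contra xT; apply: (subsetP BT).
pose A := nonnbrs S x :&: B.
pose Z := T :\: B :\: nonnbrs S x :\: nonnbrs S y.
(* [T :\: B] has [k - 2] vertices. At most [d x - #|A| - 1] of them are F-neighbours of [x], since
   [y] lies outside [T], and at most [d y - 1] are F-neighbours of [y], since [x] does too. *)
have cZ : #|A| <= #|Z|.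
  have c1 := cardsID B T; rewrite (setIidPr BT) in c1.
  have c2 := cardsID (nonnbrs S x) (T :\: B).
  have c3 := cardsID (nonnbrs S y) (T :\: B :\: nonnbrs S x).
  have c4 := cardsID B (nonnbrs S x).
  have c5 : #|(T :\: B) :&: nonnbrs S x| < #|nonnbrs S x :\: B|.
    apply: proper_card; apply/properP; split.
      by apply/subsetP => z /setIP[/setDP[_ zB] zN]; rewrite inE zB.
    exists y; last by apply/negP => /setIP[/setDP[yT' _] _]; rewrite yT' in yT.
    by rewrite inE in_nonnbrs yS xy /= andbT; apply: contra yT; apply: (subsetP BT).
  have c6 : #|(T :\: B :\: nonnbrs S x) :&: nonnbrs S y| < #|nonnbrs S y|.
    apply: proper_card; apply/properP; split; first exact: subsetIr.
    exists x; first by rewrite in_nonnbrs xS nonadjC.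
    by apply/negP => /setIP[/setDP[/setDP[xT' _] _] _]; rewrite xT' in xT.
  rewrite -/A -/Z in c2 c3 c4; lia.
have [f [finj fZ]] := inj_in_of_leq_card cZ.
have inA b : b \in B -> ~~ adj x b -> b \in A.
  move=> bB xb; have bT := subsetP BT _ bB.
  rewrite !inE bB (subsetP TS) //= andbT /nonadj xb andbT.
  by apply: contraNneq xB => ->.
exists (x |: B); last by rewrite cardsU1 xB; lia.
apply: (immersed_add (f := f) iB TS xS xT yT xney).
  move=> b bB xb; have bA := inA b bB xb.
  have := fZ b bA; rewrite !inE.
  move=> /andP[h1 /andP[h2 /andP[h3 /and3P[fy fx fS]]]].
  rewrite fS /= in h1 h2.
  split; first by split.
  split; first by rewrite -nonadjN // eq_sym.
    by rewrite adj_sym -nonadjN // eq_sym.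
  (* [y] and [b] are both F-neighbours of [x], hence adjacent. *)
  move: bA; rewrite !inE => /andP[/andP[_ xb'] _].
  by apply: adj_of_common xy xb' _; apply: contraNneq yT => ->; apply: (subsetP BT).
by move=> b c bB c_B xb xc; apply: finj; apply: inA.
Qed.

(** The vertex [w] is added to the clique of the [k - 1] F-neighbours of [v]. At most one of these,
    [a], is not adjacent to [w]; it is reached along [w - v - y - a]. *)
Lemma half_immersed_star v w :
    {in S, forall a, #|nonnbrs S a| < k} -> v \in S -> w \in S ->
    #|nonnbrs S v| = k.-1 -> w != v -> ~~ nonadj v w ->
    #|nonnbrs S w :&: nonnbrs S v| <= 1 ->
  half_immersed S.
Proof.
move=> ltk vS wS dv wv vw le1.
have wN : w \notin nonnbrs S v by rewrite inE (negbTE vw) andbF.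
have NS := nonnbrs_sub S v.
have adjN b : b \in nonnbrs S v -> b \notin nonnbrs S w -> adj w b.
  move=> bN; rewrite inE (subsetP NS) //= nonadjN //.
  by apply: contraNneq wN => ->.
have ck : 0 < k by have := ltk v vS; lia.
exists (w |: nonnbrs S v); last by rewrite cardsU1 wN dv; lia.
have cliq := clique_immersed (nonnbrs_clique S v).
have [a aN|N0] := pickP (mem (nonnbrs S w :&: nonnbrs S v)); last first.
  have adjN0 b : b \in nonnbrs S v -> adj w b.
    move=> bN; apply: adjN => //; apply/negP => bw.
    by have := N0 b; rewrite /= in_setI bw bN.
  apply: (immersed_add (y := v) (f := id) cliq NS wS wN) => //.
  - by rewrite inE nonadjxx andbF.
  - by move=> b bN; rewrite adjN0.
have uniqa b : b \in nonnbrs S v -> ~~ adj w b -> b = a.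
  move=> bN wb; move: aN => /= aN; apply/eqP.
  have bI : b \in nonnbrs S w :&: nonnbrs S v.
    by rewrite inE bN andbT; apply: contraNT wb; apply: adjN.
  by move/card_le1P: le1 => /(_ a aN b); rewrite bI inE => <-.
have /setIP[aw av] := aN.
have aS : a \in S by apply: (subsetP NS).
pose W := S :\: nonnbrs S v :\ v.
have cW : #|W| = k.-1.
  have := cardsID (nonnbrs S v) S; rewrite (setIidPr NS) dv.
  have := cardsD1 v (S :\: nonnbrs S v); rewrite !inE nonadjxx andbF vS /= -/W; lia.
(* If all [k - 1] elements of [W] were F-neighbours of [a], then with [v] there would be [k] of
   them. *)
have [y /setDP[yW ya]] : exists y, y \in W :\: nonnbrs S a.
  apply/set0Pn; rewrite setD_eq0; apply/negP => sub.
  have : v |: W \subset nonnbrs S a.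
    rewrite subUset sub andbT sub1set inE vS nonadjC.
    by move: av; rewrite inE => /andP[].
  move/subset_leq_card; rewrite cardsU1 !inE eqxx /=; have := ltk a aS; lia.
have /setD1P[yv /setDP[yS yN]] := yW.
have aw' : nonadj a w by move: aw; rewrite inE nonadjC => /andP[].
have wy : w != y by apply: contraNneq ya => <-; rewrite inE wS.
have {}av : nonadj v a by move: av; rewrite inE => /andP[].
apply: (immersed_add (y := y) (f := fun=> v) cliq NS wS wN yN wy).
  move=> b bN wb; have -> := uniqa b bN wb.
  split; first by rewrite yS vS inE nonadjxx andbF.
  split; first by rewrite -nonadjN // nonadjC.
    by rewrite -nonadjN 1?eq_sym //; move: yN; rewrite inE yS.
  rewrite adj_sym -nonadjN; first by move: ya; rewrite inE yS.
  by apply: contraNneq yN => <-; rewrite inE aS.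
by move=> b c bN cN wb wc _; rewrite (uniqa b) // (uniqa c).
Qed.

End Step.

(** A failing field hands over one of the constructions above. The clique bound is settled before
    [half_immersed_star], which needs degrees below [k]. *)
Lemma half_immersed_or_critical S :
    (forall T, #|T| < #|S| -> half_immersed T) ->
  half_immersed S \/ exists k, critical S k.
Proof.
move=> IH.
have [oS|/(half_immersed_even IH)] := boolP (odd #|S|); last by left.
pose k := uphalf #|S|; have cS : #|S|.+1 = k.*2 by rewrite /k; lia.
have [/existsP[I /and3P[IS cI le]]|] :=
  boolP [exists I : {set G}, [&& I \subset S, is_clique I & k <= #|I|]].
  by left; apply: half_immersed_clique IS cI le.
rewrite negb_exists => /forallP noI.
have cliq (I : {set G}) : I \subset S -> is_clique I -> #|I| < k.
  by move=> IS cI; have := noI I; rewrite IS cI -ltnNge.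
have [/exists_inP[x xS /eqP d0]|] := boolP [exists x in S, #|nonnbrs S x| == 0].
  by left; apply: (half_immersed_universal IH cS xS d0).
rewrite negb_exists_in => /forall_inP gt0.
have [/exists_inP[x xS /exists_inP[y yS /andP[xy le]]]|] := boolP [exists x in S,
    exists y in S, nonadj x y && (#|nonnbrs S x| + #|nonnbrs S y| <= k)].
  by left; apply: (half_immersed_edge IH cS xS yS xy le).
rewrite negb_exists_in => /forall_inP noE.
have [/exists_inP[v vS /exists_inP[w wS /and4P[/eqP d wv vw le]]]|] := boolP
    [exists v in S, exists w in S, [&& #|nonnbrs S v| == k.-1, w != v,
     ~~ nonadj v w & #|nonnbrs S w :&: nonnbrs S v| <= 1]].
  left; apply: (half_immersed_star cS _ vS wS d wv vw le) => a aS.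
  by apply: cliq; [apply: nonnbrs_sub | apply: nonnbrs_clique].
rewrite negb_exists_in => /forall_inP noV.
right; exists k; split=> //.
- move=> x y xS yS xy; have := noE x xS; rewrite negb_exists_in => /forall_inP/(_ y yS).
  by rewrite xy -ltnNge.
- by move=> x xS; rewrite lt0n gt0.
- move=> v w vS wS d wv vw; have := noV v vS; rewrite negb_exists_in => /forall_inP/(_ w wS).
  by rewrite d eqxx wv vw -ltnNge.
Qed.

End Basics.

(** * Four-vertex patterns found by counting *)

(** Double counting of the pairs in [A] and [W] joined in F. *)
Lemma sum_nonnbrs_exchange (G : sgraph) (S A W : {set G}) :
    A \subset S -> W \subset S ->
  \sum_(w in W) #|nonnbrs S w :&: A| = \sum_(a in A) #|nonnbrs S a :&: W|.
Proof.
move=> /subsetP AS /subsetP WS.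
have cE (B : {set G}) x : {subset B <= S} ->
    #|nonnbrs S x :&: B| = \sum_(b in B) nonadj x b.
  move=> BS; rewrite -sum1_card big_mkcond [RHS]big_mkcond /=; apply: eq_bigr => b _.
  rewrite !inE; case: (boolP (b \in B)) => [/BS->|_]; last by rewrite andbF.
  by rewrite andbT; case: (nonadj x b).
under eq_bigr do rewrite cE //.
rewrite exchange_big; apply: eq_bigr => a _; rewrite cE //.
by apply: eq_bigr => w _; rewrite nonadjC.
Qed.

Definition cycle5 (G : sgraph) (c0 c1 c2 c3 c4 : G) : Prop :=
  [/\ nonadj c0 c1, nonadj c1 c2, nonadj c2 c3, nonadj c3 c4 & nonadj c4 c0].

Section Critical.
Variables (G : sgraph) (S : {set G}) (k : nat).
Hypothesis alphaG : independence_number G <= 2.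
Hypothesis critS : critical S k.
Implicit Types (a b c d u v w x y z r s t : G) (A B I : {set G}).

Let tf := nonadj_triangle_free alphaG.
Let common := adj_of_common alphaG.
Local Notation N := (nonnbrs S).

Lemma critical_lt x : #|N x| < k.
Proof. by apply: (critical_clique critS); [apply: nonnbrs_sub|apply: nonnbrs_clique]. Qed.

Lemma critical_nonnbr x : x \in S -> exists2 y, y \in S & nonadj x y.
Proof.
move=> /(critical_gt0 critS); rewrite card_gt0 => /set0Pn[y].
by rewrite inE => /andP[]; exists y.
Qed.

Lemma critical_gt1 x : x \in S -> 1 < #|N x|.
Proof.
move=> xS; have [y yS xy] := critical_nonnbr xS.
have := critical_edge critS xS yS xy; have := critical_lt y; lia.
Qed.

Lemma critical_exists_edge : exists u v, [/\ u \in S, v \in S & nonadj u v].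
Proof.
have [u uS] : exists u, u \in S.
  by apply/set0Pn; rewrite -card_gt0; have := critical_card critS; lia.
by have [v vS uv] := critical_nonnbr uS; exists u, v.
Qed.

Lemma nonnbrs_disjoint u v : nonadj u v -> [disjoint N u & N v].
Proof.
move=> uv; apply/pred0P => w /=; rewrite !inE; apply/negP => /andP[/andP[_ uw] /andP[_ vw]].
exact: tf uv vw uw.
Qed.

Lemma card_outside_star v : v \in S -> #|S :\: N v :\ v| + #|N v|.+1 = #|S|.
Proof.
move=> vS; have := cardsID (N v) S; rewrite (setIidPr (nonnbrs_sub S v)).
have := cardsD1 v (S :\: N v); rewrite !inE nonadjxx vS /=; lia.
Qed.

Lemma card_nonnbrs_outside_star v a : v \in S -> nonadj v a ->
  #|N a :&: (S :\: N v :\ v)|.+1 = #|N a|.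
Proof.
move=> vS va; rewrite [RHS](cardsD1 v) inE vS nonadjC va add1n; congr _.+1.
apply: eq_card => w; rewrite in_setI !in_setD1 in_setD.
case: (boolP (w \in N a)) => [wN|]; rewrite ?andbF //= !andbT.
have -> : w \in S by apply: (subsetP (nonnbrs_sub S a)).
have -> : w \notin N v; last by rewrite !andbT.
by apply/negP => wv; have /pred0P/(_ w) := nonnbrs_disjoint va; rewrite /= wv wN.
Qed.

Lemma card_outside_edge u v : nonadj u v ->
  #|N u| + #|N v| + #|S :\: (N u :|: N v)| = #|S|.
Proof.
move=> uv; rewrite -cardsUI (disjoint_setI0 (nonnbrs_disjoint uv)) cards0 addn0.
have sub : N u :|: N v \subset S by rewrite subUset !nonnbrs_sub.
by rewrite -{1}(setIidPr sub) cardsID.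
Qed.

Lemma outside_edge_adj u v r : u \in S -> v \in S -> nonadj u v ->
  r \in S :\: (N u :|: N v) -> [/\ r \in S, adj r u & adj r v].
Proof.
move=> uS vS uv; rewrite !inE negb_or => /andP[/andP[h1 h2] rS].
rewrite rS /= in h1 h2; split=> //; rewrite adj_sym -nonadjN //.
  by apply: contraNneq h2 => <-; rewrite nonadjC.
by apply: contraNneq h1 => <-.
Qed.

Lemma exists_outside_edge u v : nonadj u v ->
  exists r, r \in S :\: (N u :|: N v).
Proof.
move=> uv; apply/set0Pn; rewrite -card_gt0.
have := card_outside_edge uv; have := critical_card critS.
have := critical_lt u; have := critical_lt v; lia.
Qed.

(** For [k <= 4] the edge bound forces a vertex [v] of degree [k - 1]. The [k] vertices outside
    [N v] are too many for a clique, so two of them are F-adjacent. By [critical_star] each has two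
    F-neighbours in [N v], none in common, but [N v] has at most three elements. *)
Lemma critical_ge5 : 4 < k.
Proof.
rewrite ltnNge; apply/negP => k4.
have [v vS dv] : exists2 v, v \in S & #|N v| = k.-1.
  have [u [v [uS vS uv]]] := critical_exists_edge.
  have := critical_edge critS uS vS uv=> sum.
  have := critical_lt u; have := critical_lt v => lv lu.
  have [du|du] := eqVneq #|N u| k.-1; first by exists u.
  by exists v => //; lia.
have cS := card_outside_star vS; have sS := critical_card critS.
have : #|S :\: N v| < k.
  apply: (critical_clique critS); first exact: subsetDl.
  apply/cliqueP => w w' /setDP[wS wN] /setDP[wS' wN']; apply/negP => ww.
  have vw : ~~ nonadj v w by apply: contra wN => vw; rewrite inE wS.
  have vw' : ~~ nonadj v w' by apply: contra wN' => vw'; rewrite inE wS'.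
  have wv : w != v by apply: contraNneq vw' => <-.
  have wv' : w' != v by apply: contraNneq vw => <-; rewrite nonadjC.
  have := critical_star critS vS wS dv wv vw.
  have := critical_star critS vS wS' dv wv' vw'.

  have : #|(N w :&: N v) :|: (N w' :&: N v)| <= #|N v|.
    by apply: subset_leq_card; rewrite subUset !subsetIr.
  rewrite cardsU -setIIl (disjoint_setI0 (nonnbrs_disjoint ww)) set0I cards0; lia.
have := cardsD1 v (S :\: N v); rewrite !inE nonadjxx vS /=; lia.
Qed.

(** The claw is in F; the names of the lemmas that follow describe the pattern in [G]. Degrees are
    at most 2, but on an F-edge they sum to more than [k >= 5]. *)
Lemma critical_claw :
  (forall u a b c, nonadj u a -> nonadj u b -> nonadj u c ->
     adj a b -> adj a c -> adj b c -> False) -> False.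
Proof.
move=> free.
have le2 x : #|N x| <= 2.
  rewrite leqNgt; apply/card_gt2P => -[a [b [c [[]]]]]; rewrite !inE.
  move=> /andP[_ xa] /andP[_ xb] /andP[_ xc] [ab bc ca].
  have ac : a != c by rewrite eq_sym.
  by apply: (free x a b c) => //; apply: (common (z := x)).
have [u [v [uS vS uv]]] := critical_exists_edge.
have := critical_edge critS uS vS uv.
by have := le2 u; have := le2 v; have := critical_ge5; lia.
Qed.

(** Neighbourhoods of F are cliques, so degrees are at most 3; as [k >= 5], the edge bound makes all
    degrees 3, [k = 5] and [#|S| = 9]. *)
Lemma critical_K4 :
  (forall a b c d, adj a b -> adj a c -> adj a d -> adj b c -> adj b d -> adj c d ->
     False) -> False.
Proof.
move=> free.
have le3 x : #|N x| <= 3.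
  rewrite leqNgt; apply/negP => lt3.
  have [a aN] : exists a, a \in N x by apply/set0Pn; rewrite -card_gt0; lia.
  have : 2 < #|N x :\ a| by have := cardsD1 a (N x); rewrite aN; lia.
  move: aN; rewrite inE => /andP[_ xa].
  case/card_gt2P => b [c [d [[]]]]; rewrite !inE.
  move=> /and3P[ba _ xb] /and3P[ca _ xc] /and3P[da _ xd] [bc cd db].
  by apply: (free a b c d); apply: (common (z := x)); rewrite // eq_sym.
have k5 := critical_ge5.
have eq3 x : x \in S -> #|N x| = 3 /\ k = 5.
  move=> xS; have [y yS xy] := critical_nonnbr xS.
  have := critical_edge critS xS yS xy.
  by have := le3 x; have := le3 y; lia.
have [v [_ [vS _ _]]] := critical_exists_edge.
have [dv k5'] := eq3 v vS; have cS := critical_card critS.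
pose W := S :\: N v :\ v.
have WS : W \subset S by apply: subset_trans (subsetDl _ _) (subsetDl _ _).
have cW : #|W| = 5 by have := card_outside_star vS; rewrite -/W; lia.
have NaW a : a \in N v -> #|N a :&: W| = 2.
  rewrite inE => /andP[aS va]; have [da _] := eq3 a aS.
  by have := card_nonnbrs_outside_star vS va; rewrite -/W; lia.
(* Six F-edges run from [N v] to the five vertices of [W]. *)
have [w wW dw] : exists2 w, w \in W & 1 < #|N w :&: N v|.
  apply/exists_inP; apply: contraT; rewrite negb_exists_in => /forall_inP le1.
  have := sum_nonnbrs_exchange (nonnbrs_sub S v) WS.
  rewrite [RHS](eq_bigr (fun=> 2)) => [|a /NaW //].
  rewrite sum_nat_const dv => eq6.
  have : \sum_(w in W) #|N w :&: N v| <= \sum_(w in W) 1.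
    by apply: leq_sum => w /le1; rewrite -leqNgt.
  by rewrite eq6 sum1_card cW.
have wS := subsetP WS _ wW.
have [dw3 _] := eq3 w wS.
(* [w] has at most one F-neighbour in [W]. Among the three vertices left, two adjacent ones would
   form a [K4] with [v] and [w], so the three are a triangle of F. *)
have : 2 < #|W :\ w :\: N w|.
  have c1 := cardsID (N w) (W :\ w).
  have c2 := cardsD1 w W; rewrite wW in c2.
  have c3 : #|((W :\ w) :&: N w) :|: (N w :&: N v)| <= #|N w|.
    by apply: subset_leq_card; rewrite subUset subsetIr subsetIl.
  rewrite cardsU in c3.
  have c4 : ((W :\ w) :&: N w) :&: (N w :&: N v) = set0.
    apply/setP => z; rewrite in_set0; apply/negP => /setIP[/setIP[/setD1P[_ zW] _] /setIP[_ zv]].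
    by move: zW => /setD1P[_ /setDP[_]]; rewrite zv.
  rewrite c4 cards0 in c3; lia.
have adjW p : p \in W -> adj v p.
  move=> /setD1P[pv /setDP[pS]]; rewrite inE pS /= => vp.
  by rewrite -nonadjN // eq_sym.
have adjw p : p \in W :\ w :\: N w -> adj w p.
  move=> /setDP[/setD1P[pw pW]]; rewrite inE (subsetP WS) //= => wp.
  by rewrite -nonadjN // eq_sym.
case/card_gt2P => p [q [r [[pW qW rW] [pq qr rp]]]].
have fin a b : a \in W :\ w :\: N w -> b \in W :\ w :\: N w -> a != b -> nonadj a b.
  move=> aW bW ab; rewrite /nonadj ab; apply/negP => ab'.
  apply: (free v w a b); rewrite ?adjW ?adjw //.
    by move: aW => /setDP[/setD1P[]].
  by move: bW => /setDP[/setD1P[]].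
by apply: tf (fin p q pW qW pq) (fin q r qW rW qr) (fin p r pW rW _); rewrite eq_sym.
Qed.

(** In F the pattern is a 4-cycle, so two vertices not joined in F share at most one F-neighbour.
    Let [x] have maximum degree [m]. If [m = k - 1], [critical_star] is violated. Otherwise at least
    [m (k - m)] F-edges go from [N x] to the [2k - 2 - m] vertices of [W], at most one to each; this
    fails for [m >= 3] and [k - m >= 2]. *)
Lemma critical_2K2 :
  (forall a b c d, nonadj a b -> nonadj b c -> nonadj c d -> nonadj d a ->
     adj a c -> adj b d -> False) -> False.
Proof.
move=> free.
have [x0 [_ [x0S _ _]]] := critical_exists_edge.
have [x xS0 xmax] := arg_maxnP (fun x => #|N x|) x0S; have xS : x \in S := xS0.
pose W := S :\: N x :\ x.
have WS : W \subset S by apply: subset_trans (subsetDl _ _) (subsetDl _ _).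
have cW := card_outside_star xS; rewrite -/W in cW.
have WP w : w \in W -> [/\ w \in S, w != x & ~~ nonadj x w].
  by move=> /setD1P[wx /setDP[wS]]; rewrite inE wS.
have le1 w : w \in W -> #|N w :&: N x| <= 1.
  move=> wW; have [wS wx xw] := WP w wW.
  rewrite leqNgt; apply/card_gt1P => -[a [b []]]; rewrite !inE.
  move=> /andP[/andP[_ wa] /andP[_ xa]] /andP[/andP[_ wb] /andP[_ xb]] ab.
  apply: (free x a w b) => //; rewrite 1?nonadjC //.
    by rewrite -nonadjN // eq_sym.
  exact: common xa xb ab.
have k5 := critical_ge5; have sS := critical_card critS; have ltx := critical_lt x.
have [dx|dx] := eqVneq #|N x| k.-1.
  have [w wW] : exists w, w \in W by apply/set0Pn; rewrite -card_gt0; lia.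
  have [wS wx xw] := WP w wW.
  by have := critical_star critS xS wS dx wx xw; rewrite ltnNge le1.
have ge3 : 2 < #|N x|.
  have [y yS xy] := critical_nonnbr xS.
  have := critical_edge critS xS yS xy.
  have := xmax y yS; lia.
have NaW a : a \in N x -> k - #|N x| <= #|N a :&: W|.
  rewrite inE => /andP[aS xa].
  have := card_nonnbrs_outside_star xS xa; rewrite -/W.
  have := critical_edge critS xS aS xa; lia.
have : #|N x| * (k - #|N x|) <= #|W|.
  rewrite -[leqRHS]sum1_card -sum_nat_const.
  apply: (@leq_trans (\sum_(w in W) #|N w :&: N x|)); last by apply: leq_sum.
  rewrite (sum_nonnbrs_exchange (nonnbrs_sub S x) WS).
  exact: leq_sum.
have [m Ed] : exists m, #|N x| = m.+3 by exists (#|N x| - 3); lia.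
have [e Ee] : exists e, k - #|N x| = e.+2 by exists (k - #|N x| - 2); lia.
rewrite Ee Ed !mulSn !mulnS; lia.
Qed.

(** If [r] is F-adjacent to neither end of an F-edge [u v], a common F-neighbour of [r] and [u]
    would give an induced path. So the neighbourhoods of [u], [v], [r] and an F-neighbour [s] of [r]
    are disjoint, with total size above [2k]. *)
Lemma critical_P4 :
  (forall a b c d, nonadj a b -> nonadj b c -> nonadj c d ->
     adj a c -> adj a d -> adj b d -> False) -> False.
Proof.
have arith (m p q e n : nat) :
  n.+1 = k.*2 -> k < m + p -> k < q + e -> m + p + (q + e) <= n -> False by lia.
move=> free.
have dis u v r : nonadj u v -> adj r u -> adj r v -> [disjoint N u & N r].
  move=> uv ru rv; apply/pred0P => p /=; rewrite !inE.
  apply/negP => /andP[/andP[_ up] /andP[_ rp]].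
  apply: (free r p u v) => //; first by rewrite nonadjC.
  apply: (common up uv); apply: contraTneq rp => ->.
  by rewrite /nonadj rv andbF.
have [u [v [uS vS uv]]] := critical_exists_edge.
have [r rR] := exists_outside_edge uv.
have [rS ru rv] := outside_edge_adj uS vS uv rR.
have [s sS rs] := critical_nonnbr rS.
have vu : nonadj v u by rewrite nonadjC.
have sr : nonadj s r by rewrite nonadjC.
have ur := dis _ _ _ uv ru rv; have vr := dis _ _ _ vu rv ru.
have su : adj s u.
  rewrite -nonadjN; last by apply: contraTneq rs => ->; rewrite /nonadj ru andbF.
  by apply/negP => su; have /pred0P/(_ s) := ur; rewrite /= !inE sS rs nonadjC su.
have sv : adj s v.
  rewrite -nonadjN; last by apply: contraTneq rs => ->; rewrite /nonadj rv andbF.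
  by apply/negP => sv; have /pred0P/(_ s) := vr; rewrite /= !inE sS rs nonadjC sv.
have us := dis _ _ _ uv su sv; have vs := dis _ _ _ vu sv su.
have : #|(N u :|: N v) :|: (N r :|: N s)| <= #|S|.
  by apply: subset_leq_card; rewrite !subUset !nonnbrs_sub.
rewrite cardsU [_ :&: _](_ : _ = set0); last first.
  apply/setP => z; rewrite in_set0 setIUl !setIUr !in_setU.
  by rewrite !disjoint_setI0 // !in_set0.
rewrite !cardsU !disjoint_setI0 ?nonnbrs_disjoint // cards0 !subn0.
exact: (arith _ _ _ _ _ (critical_card critS) (critical_edge critS uS vS uv)
  (critical_edge critS rS sS rs)).
Qed.

End Critical.

(** * Patterns found from 5-cycles *)

Section FiveCycles.
Variable G : sgraph.
Hypothesis alphaG : independence_number G <= 2.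
Implicit Types a b c d t : G.

Lemma cycle5_rot c0 c1 c2 c3 c4 : cycle5 c0 c1 c2 c3 c4 -> cycle5 c1 c2 c3 c4 c0.
Proof. by case. Qed.

(* In a triangle-free graph a closed walk of length five is an induced 5-cycle. *)
Lemma cycle5_adj c0 c1 c2 c3 c4 : cycle5 c0 c1 c2 c3 c4 -> adj c0 c2.
Proof.
case=> h01 h12 h23 h34 h40; apply: (adj_of_common alphaG (z := c1)) => //.
  by rewrite nonadjC.
apply: contraTneq h40 => c02; apply/negP => h40; rewrite -c02 in h23.
by apply: (nonadj_triangle_free alphaG h23 h34); rewrite nonadjC.
Qed.

Lemma cycle5_triangle c0 c1 c2 c3 c4 t :
  cycle5 c0 c1 c2 c3 c4 -> nonadj t c0 -> nonadj t c1 -> False.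
Proof. by case=> h01 _ _ _ _ t0 t1; apply: nonadj_triangle_free t0 h01 t1. Qed.

(** If [t] is F-adjacent to [d0], the path [t d0 d1] and the vertex [d3] force [t] to be F-adjacent
    to [d3]; a second round forces [d1], a triangle. So [t] has no F-neighbour on the cycle, and
    [c0 c1 c2] with [t] is the pattern. *)
Lemma cycle5_paw c0 c1 c2 c3 c4 t :
    (forall a b c d, nonadj a b -> nonadj b c -> adj a c -> adj a d -> adj b d ->
       adj c d -> False) ->
    cycle5 c0 c1 c2 c3 c4 -> t \notin [:: c0; c1; c2; c3; c4] -> False.
Proof.
move=> free cyc; rewrite !inE !negb_or => /and5P[t0 t1 t2 t3 t4].
have step d0 d1 d2 d3 d4 : cycle5 d0 d1 d2 d3 d4 -> t != d1 -> t != d3 ->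
    nonadj t d0 -> nonadj t d3.
  move=> cycd ne1 ne3 td0; rewrite /nonadj ne3; apply/negP => td3.
  have rot := cycle5_rot cycd.
  have a13 := cycle5_adj rot.
  have a30 := cycle5_adj (cycle5_rot (cycle5_rot rot)).
  have [h01 _ _ _ _] := cycd.
  apply: (free t d0 d1 d3) => //; last by rewrite adj_sym.
  rewrite -nonadjN //; apply/negP; exact: cycle5_triangle cycd td0.
have none d0 d1 d2 d3 d4 : cycle5 d0 d1 d2 d3 d4 -> t != d1 -> t != d3 -> t != d4 ->
    adj t d0 \/ t = d0.
  move=> cycd ne1 ne3 ne4; have [|ne0] := eqVneq t d0; first by right.
  left; rewrite -nonadjN //; apply/negP => td0.
  have td3 := step _ _ _ _ _ cycd ne1 ne3 td0.
  have rot3 := cycle5_rot (cycle5_rot (cycle5_rot cycd)).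
  have td1 := step _ _ _ _ _ rot3 ne4 ne1 td3.
  exact: cycle5_triangle cycd td0 td1.
have r1 := cycle5_rot cyc; have r2 := cycle5_rot r1.
have [a0|/eqP] := none _ _ _ _ _ cyc t1 t3 t4; last by rewrite (negbTE t0).
have [a1|/eqP] := none _ _ _ _ _ r1 t2 t4 t0; last by rewrite (negbTE t1).
have [a2|/eqP] := none _ _ _ _ _ r2 t3 t0 t1; last by rewrite (negbTE t2).
have [h01 h12 _ _ _] := cyc.
by apply: (free c0 c1 c2 t) => //; rewrite ?(cycle5_adj cyc) // adj_sym.
Qed.

(** A vertex [t] F-adjacent to neither end of a cycle edge must be F-adjacent to the opposite
    vertex, and never to two consecutive ones. No subset of the cycle meets both demands. *)
Lemma cycle5_diamond c0 c1 c2 c3 c4 t :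
    (forall a b c d, nonadj a b -> adj a c -> adj a d -> adj b c -> adj b d ->
       adj c d -> False) ->
    cycle5 c0 c1 c2 c3 c4 -> t \notin [:: c0; c1; c2; c3; c4] -> False.
Proof.
move=> free cyc; rewrite !inE !negb_or => /and5P[t0 t1 t2 t3 t4].
have opp d0 d1 d2 d3 d4 : cycle5 d0 d1 d2 d3 d4 -> t != d0 -> t != d1 -> t != d3 ->
    ~~ nonadj t d0 -> ~~ nonadj t d1 -> nonadj t d3.
  move=> cycd ne0 ne1 ne3; rewrite !nonadjN // /nonadj ne3 => td0 td1; apply/negP => td3.
  have rot := cycle5_rot cycd.
  have a13 := cycle5_adj rot.
  have a30 := cycle5_adj (cycle5_rot (cycle5_rot rot)).
  have [h01 _ _ _ _] := cycd.
  by apply: (free d0 d1 t d3) => //; rewrite adj_sym.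
have r1 := cycle5_rot cyc; have r2 := cycle5_rot r1; have r3 := cycle5_rot r2.
have r4 := cycle5_rot r3.
have T0 := cycle5_triangle cyc (t := t); have T1 := cycle5_triangle r1 (t := t).
have T2 := cycle5_triangle r2 (t := t); have T3 := cycle5_triangle r3 (t := t).
have T4 := cycle5_triangle r4 (t := t).
have O0 := opp _ _ _ _ _ cyc t0 t1 t3; have O1 := opp _ _ _ _ _ r1 t1 t2 t4.
have O2 := opp _ _ _ _ _ r2 t2 t3 t0; have O3 := opp _ _ _ _ _ r3 t3 t4 t1.
have O4 := opp _ _ _ _ _ r4 t4 t0 t2.
move: T0 T1 T2 T3 T4 O0 O1 O2 O3 O4.
by case: (nonadj t c0); case: (nonadj t c1); case: (nonadj t c2); case: (nonadj t c3);
  case: (nonadj t c4) => /=; intuition.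
Qed.

(* The vertices of [X] join the clique [A0 :|: A1] one at a time: [x] reaches [a] of
   [A0] through [f a] in [A3] and then through a vertex of [Y] used for [x] only. *)
Lemma immersed_blowup (A0 A1 A3 X Y : {set G}) :
    is_clique (A0 :|: A1) -> is_clique (A1 :|: X) ->
    {in Y & A0, forall y a, adj y a} -> {in A3 & Y, forall z y, adj z y} ->
    {in X & A3, forall x z, adj x z} ->
    {in X, forall x, x \notin A0 :|: A1 :|: A3 :|: Y} ->
    {in Y, forall y, y \notin A0 :|: A1} -> {in A3, forall z, z \notin A0 :|: A1} ->
    #|A0| <= #|A3| -> #|X| <= #|Y| ->
  immersed (A0 :|: A1 :|: A3 :|: X :|: Y) (A0 :|: A1 :|: X).
Proof.
move=> cl01 clX aY0 a3Y aX3 nX nY n3 /inj_in_of_leq_card[f [finj f3]].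
elim: {X}#|X| {-2}X (erefl #|X|) Y aY0 a3Y nY clX aX3 nX => [|n IH] X cX Y aY0 a3Y nY clX aX3 nX le.
  move/eqP: cX; rewrite cards_eq0 => /eqP->; rewrite !setU0.
  apply: immersedW (clique_immersed cl01) => //.
  by apply/subsetP => z zA; rewrite 2!in_setU zA.
have [x xX] : exists x, x \in X by apply/set0Pn; rewrite -card_gt0 cX.
have [y yY] : exists y, y \in Y by apply/set0Pn; rewrite -card_gt0; lia.
have X'X : X :\ x \subset X by apply: subsetDl.
have Y'Y : Y :\ y \subset Y by apply: subsetDl.
pose T := A0 :|: A1 :|: A3 :|: X :\ x :|: Y :\ y.
have xT : x \notin T.
  have := nX x xX; rewrite !in_setU !negb_or => /andP[-> xY].
  by rewrite !inE eqxx (negbTE xY) andbF.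
have yT : y \notin T.
  have := nY y yY; rewrite !in_setU !negb_or => ->.
  rewrite !inE eqxx /= !andbT; apply/andP; split.
    by apply/negP => y3; have := a3Y y y y3 yY; rewrite adj_irrefl.
  rewrite negb_and; apply/orP; right; apply/negP => yX.
  by have := nX y yX; rewrite inE yY orbT.
have iT : immersed T (A0 :|: A1 :|: X :\ x).
  apply: IH.
  - by have := cardsD1 x X; rewrite xX cX; lia.
  - by move=> z a /(subsetP Y'Y); apply: aY0.
  - by move=> a z a3 /(subsetP Y'Y); apply: a3Y.
  - by move=> z /(subsetP Y'Y); apply: nY.
  - move/cliqueP: clX => clX; apply/cliqueP => a b aX bX.
    by apply: clX; [move: a aX|move: b bX]; apply/subsetP/setUS.
  - by move=> z a /(subsetP X'X); apply: aX3.
  - move=> z /(subsetP X'X)/nX; apply: contra; apply/subsetP; exact: setUS.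
  - have := cardsD1 x X; have := cardsD1 y Y; rewrite xX yY; lia.
have -> : A0 :|: A1 :|: X = x |: (A0 :|: A1 :|: X :\ x).
  by rewrite setUCA setD1K.
(* [A1 :|: X] is a clique, so only vertices of [A0] need a detour. *)
have inA0 b : b \in A0 :|: A1 :|: X :\ x -> ~~ adj x b -> b \in A0.
  move=> bB xb; move: bB; rewrite -setUA in_setU => /orP[//|bB].
  have bA : b \in A1 :|: X by move: bB; apply/subsetP/setUS.
  have xA : x \in A1 :|: X by rewrite in_setU xX orbT.
  have xneb : x != b.
    apply: contraTneq bB => <-; rewrite !inE eqxx orbF.
    by have := nX x xX; rewrite !inE !negb_or => /andP[/andP[/andP[_ ->]]].
  by move/cliqueP: clX => /(_ x b xA bA); rewrite nonadjN // (negbTE xb).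
apply: (immersed_add (y := y) (f := f) iT) => //.
- by apply: setUSS => //; apply: setUS.
- by rewrite !inE xX !orbT.
- by apply: contraTneq xX => ->; apply/negP => /nX; rewrite in_setU yY orbT.
- move=> b bB xb; have bA0 := inA0 b bB xb.
  have fb := f3 b bA0.
  split; split; rewrite ?inE ?yY ?fb ?orbT //.
  + rewrite !negb_or; have := n3 _ fb; rewrite !inE negb_or => ->.
    rewrite negb_and; apply/orP; right; apply/negP => fX.
    by have := aX3 _ _ fX fb; rewrite adj_irrefl.
  + exact: aX3.
  + exact: a3Y.
  + exact: aY0.
- by move=> b c bB cB xb xc; apply: finj; apply: inA0.
Qed.

End FiveCycles.

Section CriticalFiveCycles.
Variables (G : sgraph) (S : {set G}) (k : nat).
Hypothesis alphaG : independence_number G <= 2.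
Hypothesis critS : critical S k.
Implicit Types (a b c d u v w x y z r s t : G).
Local Notation N := (nonnbrs S).

(** As [#|S| = 2k - 1 >= 9], a 5-cycle never exhausts [S]. *)
Lemma critical_outside_seq (l : seq G) :
  size l <= 5 -> exists2 t, t \in S & t \notin l.
Proof.
move=> le5; have k5 := critical_ge5 alphaG critS; have cS := critical_card critS.
have [t /setDP[tS tl]] : exists t, t \in S :\: [set x in l].
  apply/set0Pn; rewrite -card_gt0.
  have := cardsID [set x in l] S.
  have := subset_leq_card (subsetIr S [set x in l]).
  have : #|[set x in l]| <= 5 by rewrite cardsE; apply: leq_trans (card_size l) le5.
  lia.
by exists t => //; move: tl; rewrite inE.
Qed.

Lemma critical_other_nonnbr u v : u \in S ->
  exists p, [/\ p \in S, nonadj u p & p != v].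
Proof.
move=> uS; have /card_gt1P[p [q [pN qN pq]]] := critical_gt1 alphaG critS uS.
move: pN qN; rewrite !inE => /andP[pS up] /andP[qS uq].
have [pv|] := eqVneq p v; last by exists p.
by exists q; split=> //; rewrite -pv eq_sym.
Qed.

(** Take [r] F-adjacent to neither end of an F-edge [u v]. A further F-neighbour [p] of [u] is
    F-adjacent to [r], or else [v u p] with [r] is the pattern; likewise for [q] at [v]. This closes
    the 5-cycle [u p r q v]. *)
Lemma critical_paw :
  (forall a b c d, nonadj a b -> nonadj b c -> adj a c -> adj a d -> adj b d ->
     adj c d -> False) -> False.
Proof.
move=> free.
have [u [v [uS vS uv]]] := critical_exists_edge alphaG critS.
have [r rR] := exists_outside_edge alphaG critS uv.
have [rS ru rv] := outside_edge_adj uS vS uv rR.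
have nbr x y p : nonadj x y -> adj r x -> adj r y -> nonadj x p -> p != y -> nonadj p r.
  move=> xy rx ry xp py; rewrite /nonadj; apply/andP; split.
    by apply: contraTneq xp => ->; rewrite /nonadj adj_sym rx andbF.
  apply/negP => pr; apply: (free y x p r) => //; rewrite 1?adj_sym 1?nonadjC //.
  by apply: (adj_of_common alphaG xp xy).
have [p [pS up pv]] := critical_other_nonnbr v uS.
have [q [qS vq qu]] := critical_other_nonnbr u vS.
have vu : nonadj v u by rewrite nonadjC.
have cyc : cycle5 u p r q v.
  split=> //; first exact: nbr uv ru rv up pv.
    by rewrite nonadjC; exact: nbr vu rv ru vq qu.
  by rewrite nonadjC.
have [//|t tS tn] := @critical_outside_seq [:: u; p; r; q; v].
exact: cycle5_paw free cyc tn.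
Qed.

(** Otherwise [r] would extend [N u] to a clique of size [k]. *)
Lemma critical_nonnbrs_meet u r : #|N u| = k.-1 -> r \in S -> r \notin N u ->
  exists2 p, p \in S & nonadj u p /\ nonadj p r.
Proof.
move=> du rS rN.
have [p /setIP[]|none] := pickP (mem (N u :&: N r)).
  by rewrite !inE => /andP[pS up] /andP[_ rp]; exists p => //; rewrite (nonadjC p).
have : #|r |: N u| < k.
  apply: (critical_clique critS); first by rewrite subUset sub1set rS nonnbrs_sub.
  have rp p : p \in N u -> ~~ nonadj r p.
    move=> pN; apply/negP => rp; have := none p; rewrite /= in_setI pN inE rp.
    by rewrite (subsetP (nonnbrs_sub S u)).
  apply/cliqueP => x y /setU1P[->|xN] /setU1P[->|yN]; rewrite ?nonadjxx ?rp //.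
    by rewrite nonadjC rp.
  by move/cliqueP: (nonnbrs_clique alphaG S u); apply.
by rewrite cardsU1 rN du; have := critical_ge5 alphaG critS; lia.
Qed.

(** The vertices of [R], F-adjacent to neither end of the F-edge [u v], are pairwise F-adjacent, so
    there are at most two. Since [d u + d v + #|R| = 2k - 1], a single one makes both degrees
    [k - 1], and two make one of the degrees [k - 1]; [critical_nonnbrs_meet] then closes a 5-cycle
    through [R]. *)
Lemma critical_diamond :
  (forall a b c d, nonadj a b -> adj a c -> adj a d -> adj b c -> adj b d ->
     adj c d -> False) -> False.
Proof.
move=> free.
suff [c0 [c1 [c2 [c3 [c4 cyc]]]]] : exists c0 c1 c2 c3 c4 : G, cycle5 c0 c1 c2 c3 c4.
  have [//|t tS tn] := @critical_outside_seq [:: c0; c1; c2; c3; c4].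
  exact: cycle5_diamond free cyc tn.
have arith (m p q n : nat) : n.+1 = k.*2 -> m < k -> p < k -> m + p + q = n ->
    (q <= 1 -> m = k.-1 /\ p = k.-1) /\ (q <= 2 -> m = k.-1 \/ p = k.-1).
  by lia.
have [u [v [uS vS uv]]] := critical_exists_edge alphaG critS.
have [r rR] := exists_outside_edge alphaG critS uv.
have vu : nonadj v u by rewrite nonadjC.
pose R := S :\: (N u :|: N v).
have RN x : x \in R -> [/\ x \in S, x \notin N u & x \notin N v].
  by rewrite in_setD in_setU negb_or => /andP[/andP[]].
have Radj x y : x \in R -> y \in R -> x != y -> nonadj x y.
  move=> xR yR xy; rewrite /nonadj xy; apply/negP => xy'.
  have [_ xu xv] := outside_edge_adj uS vS uv xR.
  have [_ yu yv] := outside_edge_adj uS vS uv yR.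
  by apply: (free u v x y) => //; rewrite adj_sym.
have le2 : #|R| <= 2.
  rewrite leqNgt; apply/card_gt2P => -[x [y [z [[xR yR zR] [xy yz zx]]]]].
  have xz : x != z by rewrite eq_sym.
  exact: nonadj_triangle_free (Radj _ _ xR yR xy) (Radj _ _ yR zR yz) (Radj _ _ xR zR xz).
have [ar1 ar2] := arith _ _ _ _ (critical_card critS) (critical_lt alphaG critS u)
  (critical_lt alphaG critS v) (card_outside_edge S alphaG uv).
have [rS ruN rvN] := RN r rR.
have [le1|/card_gt1P[x [y [xR yR xy]]]] := leqP #|R| 1.
  have [du dv] := ar1 le1.
  have [p pS [up pr]] := critical_nonnbrs_meet du rS ruN.
  have [q qS [vq qr]] := critical_nonnbrs_meet dv rS rvN.
  by exists u, p, r, q, v; split; rewrite // nonadjC.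
have [xS xu xv] := RN x xR; have [yS yu yv] := RN y yR; have nxy := Radj x y xR yR xy.
have [du|dv] := ar2 le2.
  have [p pS [up pr]] := critical_nonnbrs_meet du xS xu.
  have [q qS [uq qr]] := critical_nonnbrs_meet du yS yu.
  by exists u, p, x, y, q; split; rewrite // nonadjC.
have [p pS [vp pr]] := critical_nonnbrs_meet dv xS xv.
have [q qS [vq qr]] := critical_nonnbrs_meet dv yS yv.
by exists v, p, x, y, q; split; rewrite // nonadjC.
Qed.

(** * Avoiding an induced 4-cycle in [G], that is, [2K_2] in F *)

Section SquareFree.
Hypothesis free : forall a b c d,
  nonadj a b -> nonadj c d -> adj a c -> adj a d -> adj b c -> adj b d -> False.

(** [R] is a clique. If none of its vertices has F-neighbours in both [N u] and [N v], it splits so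
    that [N u :|: R1] and [N v :|: R2] are cliques. These cover [S] with at most [2k - 2] vertices,
    a contradiction. *)
Lemma critical_exists_cycle5 : exists c0 c1 c2 c3 c4 : G,
  cycle5 c0 c1 c2 c3 c4.
Proof.
have [u [v [uS vS uv]]] := critical_exists_edge alphaG critS.
pose R := S :\: (N u :|: N v).
have RN x : x \in R -> [/\ x \in S, x \notin N u & x \notin N v].
  by rewrite in_setD in_setU negb_or => /andP[/andP[]].
have Radj x y : x \in R -> y \in R -> ~~ nonadj x y.
  move=> xR yR; apply/negP => xy.
  have [_ xu xv] := outside_edge_adj uS vS uv xR.
  have [_ yu yv] := outside_edge_adj uS vS uv yR.
  by apply: (free uv xy); rewrite adj_sym.
have [/exists_inP[r rR /andP[/set0Pn[p pI] /set0Pn[q qI]]]|] := boolP [exists r in R,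
    (N r :&: N u != set0) && (N r :&: N v != set0)].
  move: pI qI; rewrite !inE.
  move=> /andP[/andP[pS rp] /andP[_ up]] /andP[/andP[qS rq] /andP[_ vq]].
  by exists u, p, r, q, v; split; rewrite // nonadjC.
rewrite negb_exists_in => /forall_inP none.
pose R1 := [set r in R | N r :&: N u == set0].
pose R2 := [set r in R | N r :&: N u != set0].
have lt x (Q : {set G}) : Q \subset R -> {in Q, forall r, N r :&: N x = set0} ->
    #|N x| + #|Q| < k \/ exists2 r, r \in Q & r \in N x.
  move=> QR Q0.
  have [/pred0P dis|/pred0Pn[r /andP[rQ rN]]] := boolP [disjoint Q & N x]; last by right; exists r.
  left.
  have -> : #|N x| + #|Q| = #|N x :|: Q|.
    rewrite cardsU [_ :&: _](_ : _ = set0) ?cards0 ?subn0 //.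
    by apply/setP => r; rewrite in_set0 setIC; have := dis r; rewrite /= in_setI.
  apply: (critical_clique critS).
    rewrite subUset nonnbrs_sub; apply: subset_trans QR _; exact: subsetDl.
  have QN r p : r \in Q -> p \in N x -> ~~ nonadj r p.
    move=> rQ pN; apply/negP => rp; have /setP/(_ p) := Q0 r rQ.
    by rewrite in_setI pN inE rp (subsetP (nonnbrs_sub S x)) // in_set0.
  apply/cliqueP => a b /setUP[aN|aQ] /setUP[bN|bQ].
  - by move/cliqueP: (nonnbrs_clique alphaG S x); apply.
  - by rewrite nonadjC QN.
  - by rewrite QN.
  - by apply: Radj; apply: (subsetP QR).
have R1R : R1 \subset R by apply/subsetP => r; rewrite inE => /andP[].
have R2R : R2 \subset R by apply/subsetP => r; rewrite inE => /andP[].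
have cR : #|R1| + #|R2| = #|R|.
  rewrite -(cardsID R1 R) (setIidPr R1R); congr (_ + _); apply: eq_card => r.
  have e1 : (r \in R1) = (r \in R) && (N r :&: N u == set0) by rewrite in_set.
  have e2 : (r \in R2) = (r \in R) && (N r :&: N u != set0) by rewrite in_set.
  by rewrite in_setD e1 e2; case: (r \in R); rewrite /= ?andbT ?andbF.
have cE := card_outside_edge S alphaG uv; have cS := critical_card critS.
have [|l1|[r /(subsetP R1R)/RN[_ /negP]]] := lt u R1 R1R; last by [].
  by move=> r; rewrite inE => /andP[_ /eqP].
have [|l2|[r /(subsetP R2R)/RN[_ _ /negP]]] := lt v R2 R2R; last by [].
  move=> r; rewrite inE => /andP[rR ne]; have := none r rR.
  by rewrite ne /= negbK => /eqP.
rewrite -/R -cR in cE; lia.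
Qed.

Section Blowup.
Variables c0 c1 c2 c3 c4 : G.
Hypothesis cyc : cycle5 c0 c1 c2 c3 c4.

(** The five sets are the classes of a blow-up of the cycle. The F-edges [c0 t] and [c2 c3] cannot
    form an induced [2K_2], so one F-neighbour of [t] on the cycle brings a second one at distance
    two. *)
Lemma cycle5_dominating t : t \in S ->
  t \in (N c4 :&: N c1) :|: (N c0 :&: N c2) :|: (N c1 :&: N c3)
        :|: (N c2 :&: N c4) :|: (N c3 :&: N c0).
Proof.
move=> tS.
have [h0 h1 h2 h3 h4] := cyc.
rewrite !in_setU !in_setI !in_nonnbrs tS /=.
have [->|t0] := eqVneq t c0; first by rewrite h4 (nonadjC c1) h0.
have [->|t1] := eqVneq t c1; first by rewrite h0 (nonadjC c2) h1 !orbT.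
have [->|t2] := eqVneq t c2; first by rewrite h1 (nonadjC c3) h2 !orbT.
have [->|t3] := eqVneq t c3; first by rewrite h2 (nonadjC c4) h3 !orbT.
have [->|t4] := eqVneq t c4; first by rewrite h3 (nonadjC c0) h4 !orbT.
have step d0 d1 d2 d3 d4 : cycle5 d0 d1 d2 d3 d4 -> d2 != t -> d3 != t ->
    nonadj d0 t -> nonadj d2 t || nonadj d3 t.
  move=> cycd ne2 ne3 td0; apply: contraT; rewrite negb_or !nonadjN // => /andP[a2 a3].
  have a02 := cycle5_adj alphaG cycd.
  have a30 := cycle5_adj alphaG (cycle5_rot (cycle5_rot (cycle5_rot cycd))).
  have [_ _ h23 _ _] := cycd.
  by case: (free td0 h23 a02 _ _ _); rewrite // adj_sym.
have r1 := cycle5_rot cyc; have r2 := cycle5_rot r1; have r3 := cycle5_rot r2.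
have r4 := cycle5_rot r3.
rewrite eq_sym in t0; rewrite eq_sym in t1; rewrite eq_sym in t2.
rewrite eq_sym in t3; rewrite eq_sym in t4.
have S0 := step _ _ _ _ _ cyc t2 t3; have S1 := step _ _ _ _ _ r1 t3 t4.
have S2 := step _ _ _ _ _ r2 t4 t0; have S3 := step _ _ _ _ _ r3 t0 t1.
have S4 := step _ _ _ _ _ r4 t1 t2.
(* Otherwise an F-neighbour [w] of [t] is F-adjacent to an end of every cycle edge; a vertex cover
   of a 5-cycle contains two consecutive vertices, which gives a triangle. *)
have : [|| nonadj c0 t, nonadj c1 t, nonadj c2 t, nonadj c3 t | nonadj c4 t].
  apply: contraT; rewrite !negb_or => /and5P[n0 n1 n2 n3 n4].
  have [w wS tw] := critical_nonnbr critS tS.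
  have out c : ~~ nonadj c t -> w != c by apply: contraNneq => <-; rewrite nonadjC.
  have edge d0 d1 : nonadj d0 d1 -> ~~ nonadj d0 t -> ~~ nonadj d1 t ->
      d0 != t -> d1 != t -> nonadj w d0 || nonadj w d1.
    move=> d01 n0' n1' ne0 ne1; apply: contraT; rewrite negb_or.
    rewrite !nonadjN ?out // => /andP[w0 w1]; rewrite !nonadjN // in n0' n1'.
    by case: (free d01 tw n0' _ n1' _); rewrite // adj_sym.
  have T0 := cycle5_triangle alphaG cyc (t := w).
  have T1 := cycle5_triangle alphaG r1 (t := w).
  have T2 := cycle5_triangle alphaG r2 (t := w).
  have T3 := cycle5_triangle alphaG r3 (t := w).
  have T4 := cycle5_triangle alphaG r4 (t := w).
  move: T0 T1 T2 T3 T4 (edge _ _ h0 n0 n1 t0 t1) (edge _ _ h1 n1 n2 t1 t2).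
  move: (edge _ _ h2 n2 n3 t2 t3) (edge _ _ h3 n3 n4 t3 t4) (edge _ _ h4 n4 n0 t4 t0).
  by case: (nonadj w c0); case: (nonadj w c1); case: (nonadj w c2); case: (nonadj w c3);
    case: (nonadj w c4) => /=; intuition.
move: S0 S1 S2 S3 S4.
by case: (nonadj c0 t); case: (nonadj c1 t); case: (nonadj c2 t); case: (nonadj c3 t);
    case: (nonadj c4 t) => /=; intuition.
Qed.

(** [A0 :|: A2] and [A2 :|: A4] are cliques, inside [N c1] and [N c3], so only pairs between [A0]
    and [A4] need detours; these run through [A1] and [A3]. As each neighbourhood has fewer than [k]
    of the [2k - 1] vertices, [A3] and [A4] both have at least [k - #|A0| - #|A2|] elements. *)
Lemma half_immersed_cycle5 :
  #|N c4 :&: N c1| <= #|N c0 :&: N c2| -> half_immersed S.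
Proof.
have arith (m0 m1 m2 m3 m4 n : nat) : n.+1 = k.*2 -> n <= m0 + m1 + m2 + m3 + m4 ->
    m0 + m2 < k -> m1 + m3 < k -> m4 + m1 < k ->
    k - (m0 + m2) <= m3 /\ k - (m0 + m2) <= m4 /\ m0 + m2 + (k - (m0 + m2)) = k.
  by lia.
pose A0 := N c4 :&: N c1; pose A1 := N c0 :&: N c2; pose A2 := N c1 :&: N c3.
pose A3 := N c2 :&: N c4; pose A4 := N c3 :&: N c0.
rewrite -/A0 -/A1 => le01.
have [h0 h1 h2 h3 h4] := cyc.
have dis (x y t : G) : nonadj x y -> t \in N x -> t \notin N y.
  move=> xy; rewrite !inE => /andP[_ xt]; apply/negP => /andP[_ yt].
  exact: nonadj_triangle_free xy yt xt.
have h0' : nonadj c1 c0 by rewrite nonadjC.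
have h1' : nonadj c2 c1 by rewrite nonadjC.
have h2' : nonadj c3 c2 by rewrite nonadjC.
have h3' : nonadj c4 c3 by rewrite nonadjC.
have h4' : nonadj c0 c4 by rewrite nonadjC.
have cov : #|S| <= #|A0| + #|A1| + #|A2| + #|A3| + #|A4|.
  apply: leq_trans (subset_leq_card (introT subsetP cycle5_dominating)) _.
  do 4 (apply: leq_trans (leq_card_setU _ _).1 _; rewrite leq_add2r).
  exact: leqnn.
have sumlt (A B : {set G}) c : A \subset N c -> B \subset N c -> A :&: B = set0 ->
    #|A| + #|B| < k.
  move=> Ac Bc AB; have := cardsUI A B; rewrite AB cards0 addn0 => <-.
  apply: leq_ltn_trans (critical_lt alphaG critS c).
  by apply: subset_leq_card; rewrite subUset Ac.
have A02 : A0 :&: A2 = set0.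
  apply/setP => t; rewrite in_set0; apply/negP => /setIP[/setIP[t4 _] /setIP[_ t3]].
  by move: (dis _ _ _ h3 t3); rewrite t4.
have A13 : A1 :&: A3 = set0.
  apply/setP => t; rewrite in_set0; apply/negP => /setIP[/setIP[t4 _] /setIP[_ t3]].
  by move: (dis _ _ _ h4 t3); rewrite t4.
have A41 : A4 :&: A1 = set0.
  apply/setP => t; rewrite in_set0; apply/negP => /setIP[/setIP[t4 _] /setIP[_ t3]].
  by move: (dis _ _ _ h2 t3); rewrite t4.
have [le3 [le4 eqk]] := arith _ _ _ _ _ _ (critical_card critS) cov
  (sumlt _ _ c1 (subsetIr _ _) (subsetIl _ _) A02)
  (sumlt _ _ c2 (subsetIr _ _) (subsetIl _ _) A13)
  (sumlt _ _ c0 (subsetIr _ _) (subsetIl _ _) A41).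
have [X X4 cX] := exists_subset_card le4.
have cl c (A : {set G}) : A \subset N c -> is_clique A.
  move=> /subsetP sub; apply/cliqueP => x y /sub xN /sub yN.
  by move/cliqueP: (nonnbrs_clique alphaG S c); apply.
have cadj c x y : x \in N c -> y \in N c -> x != y -> adj x y.
  move=> xN yN xy; rewrite -nonadjN //.
  by move/cliqueP: (nonnbrs_clique alphaG S c); apply.
have neq c c' x y : nonadj c c' -> x \in N c -> y \in N c' -> x != y.
  by move=> cc' xN yN; apply: contraTneq yN => <-; apply: dis xN.
have AS (A : {set G}) c : A \subset N c -> A \subset S.
  by move=> Ac; apply: subset_trans Ac (nonnbrs_sub _ _).
have XS : X \subset S by apply: subset_trans X4 (AS _ c0 (subsetIr _ _)).
(* The sets [A1], [A3] and [Y] of [immersed_blowup] are here [A2], [A1] and [A3]. *)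
have imm : immersed (A0 :|: A2 :|: A1 :|: X :|: A3) (A0 :|: A2 :|: X).
  apply: (immersed_blowup alphaG) => //; rewrite ?cX //.
  - by apply: (cl c1); rewrite subUset subsetIr subsetIl.
  - apply: (cl c3); rewrite subUset subsetIr (subset_trans X4) //; exact: subsetIl.
  - move=> y a /setIP[y2 y4] /setIP[a4 a1]; apply: (cadj c4) => //; exact: neq y2 a1.
  - move=> z y /setIP[z0 z2] /setIP[y2 y4]; apply: (cadj c2) => //; exact: neq z0 y4.
  - move=> x z /(subsetP X4)/setIP[x3 x0] /setIP[z0 z2]; apply: (cadj c0) => //.
    exact: neq x3 z2.
  - move=> x /(subsetP X4)/setIP[x3 x0]; rewrite !in_setU !in_setI.
    rewrite (negbTE (dis _ _ _ h3 x3)) (negbTE (dis _ _ _ h0 x0)).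
    by rewrite (negbTE (dis _ _ _ h2' x3)) !andbF.
  - move=> y /setIP[y2 y4]; rewrite !in_setU !in_setI.
    by rewrite (negbTE (dis _ _ _ h1' y2)) !andbF.
  - move=> z /setIP[z0 z2]; rewrite !in_setU !in_setI.
    by rewrite (negbTE (dis _ _ _ h0 z0)) !andbF.
exists (A0 :|: A2 :|: X).
  apply: immersedW imm => //; rewrite !subUset XS.
  by rewrite (AS A0 c1) ?subsetIr // (AS A2 c3) ?subsetIr // (AS A1 c2) ?subsetIr //
    (AS A3 c4) ?subsetIr.
have -> : #|A0 :|: A2 :|: X| = #|A0| + #|A2| + #|X|.
  have := cardsUI (A0 :|: A2) X; have := cardsUI A0 A2; rewrite A02 cards0 addn0 => ->.
  rewrite [(_ :|: _) :&: X](_ : _ = set0) ?cards0 ?addn0 //.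
  apply/setP => t; rewrite in_set0; apply/negP => /setIP[tA /(subsetP X4)/setIP[t3 t0]].
  move: tA; rewrite !in_setU !in_setI (negbTE (dis _ _ _ h3 t3)).
  by rewrite (negbTE (dis _ _ _ h0 t0)).
by rewrite cX eqk; have := critical_card critS; lia.
Qed.
End Blowup.

(** Reversing the cycle exchanges the two classes compared. This pattern ends in an immersion, the
    others in a contradiction. *)
Lemma critical_C4 : half_immersed S.
Proof.
have [c0 [c1 [c2 [c3 [c4 cyc]]]]] := critical_exists_cycle5.
have [le|/ltnW le] := leqP #|N c4 :&: N c1| #|N c0 :&: N c2|.
  exact: half_immersed_cycle5 cyc le.
have [h0 h1 h2 h3 h4] := cyc.
apply: (@half_immersed_cycle5 c1 c0 c4 c3 c2) => //; first by split; rewrite nonadjC.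
by rewrite setIC (setIC (N c1)).
Qed.
End SquareFree.
End CriticalFiveCycles.

(** * Forbidden graphs on at most four vertices *)

(** Here [false] includes distinctness, so a pattern of joined vertices determines an injective
    map. *)
Definition joined (G : sgraph) (b : bool) (x y : G) : bool :=
  if b then adj x y else nonadj x y.

Lemma joinedC (G : sgraph) b (x y : G) : joined b x y = joined b y x.
Proof. by case: b; rewrite /= 1?adj_sym 1?nonadjC. Qed.

Lemma joined_adj (G : sgraph) b (x y : G) : joined b x y -> adj x y = b.
Proof. by case: b => //= /nonadj_adj/negbTE. Qed.

Lemma joined_neq (G : sgraph) b (x y : G) : joined b x y -> x != y.
Proof.
by case: b => /= [xy|/nonadj_neq//]; apply: contraTneq xy => ->; rewrite adj_irrefl.
Qed.

(** The tactics recognize a pattern up to isomorphism by trying all 24 orders of its vertices. *)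
Ltac match_pattern free x0 x1 x2 x3 :=
  solve [apply: (free x0 x1 x2 x3) => /=;
         first [assumption | rewrite adj_sym; assumption | rewrite nonadjC; assumption]].

Ltac match_pattern_last free x0 x1 x2 x3 :=
  first [match_pattern free x0 x1 x2 x3 | match_pattern free x0 x1 x3 x2
       | match_pattern free x0 x2 x1 x3 | match_pattern free x0 x2 x3 x1
       | match_pattern free x0 x3 x1 x2 | match_pattern free x0 x3 x2 x1].

Ltac match_pattern_any free :=
  let x0 := fresh in let x1 := fresh in let x2 := fresh in let x3 := fresh in
  move=> x0 x1 x2 x3 ? ? ? ? ? ?;
  first [match_pattern_last free x0 x1 x2 x3 | match_pattern_last free x1 x0 x2 x3
       | match_pattern_last free x2 x0 x1 x3 | match_pattern_last free x3 x0 x1 x2].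

(** The Boolean conditions exclude three pairwise non-adjacent vertices from the pattern. The
    complements left are the labelled copies of the seven triangle-free graphs on four vertices, one
    for each pattern lemma above. *)
Lemma half_immersed_of_free (G : sgraph) (b01 b02 b03 b12 b13 b23 : bool) :
    independence_number G <= 2 ->
    [|| b01, b02 | b12] -> [|| b01, b03 | b13] ->
    [|| b02, b03 | b23] -> [|| b12, b13 | b23] ->
    (forall x0 x1 x2 x3 : G, joined b01 x0 x1 -> joined b02 x0 x2 -> joined b03 x0 x3 ->
       joined b12 x1 x2 -> joined b13 x1 x3 -> joined b23 x2 x3 -> False) ->
  forall S : {set G}, half_immersed S.
Proof.
move=> alphaG t012 t013 t023 t123 free S.
elim: {S}#|S| {-2}S (leqnn #|S|) => [|n IH] S leS.
  exists set0; first exact: immersed0.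
  by move: leS; rewrite leqn0 => /eqP->.
have {}IH (T : {set G}) : #|T| < #|S| -> half_immersed T.
  by move=> lt; apply: IH; rewrite -ltnS (leq_trans lt).
have [//|[k crit]] := half_immersed_or_critical alphaG IH.
clear IH leS n.
case: b01 b02 b03 b12 b13 b23 t012 t013 t023 t123 free => [] [] [] [] [] [] // _ _ _ _ free;
  first [by apply: (critical_C4 alphaG crit); match_pattern_any free | exfalso;
  first [by apply: (critical_K4 alphaG crit); match_pattern_any free
       | by apply: (critical_diamond alphaG crit); match_pattern_any free
       | by apply: (critical_paw alphaG crit); match_pattern_any free
       | by apply: (critical_claw alphaG crit); match_pattern_any free
       | by apply: (critical_P4 alphaG crit); match_pattern_any free
       | by apply: (critical_2K2 alphaG crit); match_pattern_any free]].
Qed.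

Lemma is_free_embedding (G H : sgraph) (f : H -> G) :
  is_free G H -> injective f -> (forall a b, adj (f a) (f b) = adj a b) -> False.
Proof.
move=> free inj fadj.
pose S := [set f a | a in H].
have fS a : f a \in S by apply: imset_f.
apply: (free S).
have ex (x : induced S) : exists a, f a == val x.
  by have /imsetP[a _ ->] := valP x; exists a.
pose g (x : induced S) : H := xchoose (ex x).
have fg x : f (g x) = val x by apply/eqP: (xchooseP (ex x)).
exists g; last by move=> x y; rewrite -fadj !fg.
exists (fun a => Sub (f a) (fS a) : induced S) => [x|a].
  by apply: val_inj; rewrite /= fg.
by apply: inj; rewrite fg.
Qed.

Theorem theorem1p4 (G H : sgraph)
    (alphaG : independence_number G <= 2)
    (alphaH : independence_number H <= 2)
    (cardH : #|H| <= 4)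
    (freeGH : is_free G H) :
  immersion G (complete (uphalf #|G|)).
Proof.
pose s := enum H.
(* If it has fewer than four vertices, [H] is padded with universal vertices. *)
pose h i j := if (onth s i, onth s j) is (Some a, Some b) then @adj H a b else true.
have s_uniq : uniq s by apply: enum_uniq.
have size_s : size s <= 4 by rewrite -cardE.
have hnonadj i j a b : i != j -> onth s i = Some a -> onth s j = Some b -> nonadj a b = ~~ h i j.
  move=> ij ia jb; rewrite /nonadj /h ia jb.
  suff -> : a != b by [].
  have lt l c : onth s l = Some c -> l < size s by move=> lc; rewrite -onthTE lc.
  rewrite -(onth_nth a _ _ _ ia) -(onth_nth a _ _ _ jb) nth_uniq ?(lt _ _ ia) ?(lt _ _ jb) //.
(* Padding indices count as adjacent to all others, so only triples of genuine vertices of [H]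
   matter, and [alphaH] settles these. *)
have triple i j l : i != j -> i != l -> j != l -> [|| h i j, h i l | h j l].
  move=> ij il jl; apply: contraT; rewrite !negb_or => /and3P[].
  case ia: (onth s i) => [a|]; last by rewrite /h ia.
  case jb: (onth s j) => [b|]; last by rewrite /h ia jb.
  case lc: (onth s l) => [c|]; last by rewrite /h ia lc.
  rewrite -(hnonadj _ _ _ _ ij ia jb) -(hnonadj _ _ _ _ il ia lc) -(hnonadj _ _ _ _ jl jb lc).
  by move=> ab ac bc; case: (nonadj_triangle_free alphaH ab bc ac).
have half : half_immersed [set: G].
  apply: (@half_immersed_of_free G (h 0 1) (h 0 2) (h 0 3) (h 1 2) (h 1 3) (h 2 3));
    rewrite ?triple //.
  move=> x0 x1 x2 x3 j01 j02 j03 j12 j13 j23.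
  pose X := [:: x0; x1; x2; x3].
  have hC i j : h i j = h j i.
    by rewrite /h; case: (onth s i); case: (onth s j) => // a b; rewrite adj_sym.
  have jX i j : i < 4 -> j < 4 -> i != j -> joined (h i j) (nth x0 X i) (nth x0 X j).
    by case: i j => [|[|[|[|]]]] [|[|[|[|]]]] //= _ _ _; rewrite joinedC hC.
  (* Only the first [#|H|] of the four vertices are used as images. *)
  pose f a := nth x0 X (index a s).
  have lt4 a : index a s < 4.
    by apply: leq_trans size_s; rewrite index_mem mem_enum.
  have ons a : onth s (index a s) = Some a.
    have lt : index a s < size s by rewrite index_mem mem_enum.
    case E: (onth s (index a s)) (onthTE s (index a s)) => [b|]; rewrite lt // => _.
    by rewrite -(onth_nth a _ _ _ E) nth_index ?mem_enum.
  have idx a b : a != b -> index a s != index b s.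
    apply: contra_neq => ab; apply: (index_inj a _ _ ab); rewrite mem_enum //.
  apply: (is_free_embedding (f := f) freeGH).
    move=> a b; apply: contra_eq => ab.
    exact: joined_neq (jX _ _ (lt4 a) (lt4 b) (idx _ _ ab)).
  move=> a b; have [->|ab] := eqVneq a b; first by rewrite !adj_irrefl.
  by rewrite (joined_adj (jX _ _ (lt4 a) (lt4 b) (idx _ _ ab))) /h !ons.
(* [B] is trimmed to exactly [uphalf #|G|] vertices, the order of the complete graph sought. *)
have [B iB cB] := half_immersed_exact half (leqnn _).
by rewrite -cardsT -cB; apply: immersion_of_immersed.
Qed.
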